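(* Let $n\ge2$, let $\mathcal{X}=\{x_i\}_{i=1}^m$ be a frame for $\mathbb{R}^n$, and let $\tilde{\theta}_{\mathcal{X}}$ be the reduced diagram matrix of $\mathcal{X}$. Assume that $\tilde{\theta}_{\mathcal{X}}$ has rank $m-2$, and let $R_1,\dots,R_{m-2}\in\mathbb{R}^m$ be $m-2$ linearly independent rows of $\tilde{\theta}_{\mathcal{X}}$. Let $w_1,w_2\in\mathbb{R}^m$ be such that the set $\{w_1,w_2,R_1,\dots,R_{m-2}\}$ is linearly independent. Let $E=(\alpha_1,\dots,\alpha_m)$ be a vector of coefficients. Then $\mathcal{X}$ is scalable if and only if there exists $t\in[0,2\pi)$ for which the cofactors of the $\alpha_j$ in the expansion of the determinant of the $m\times m$ matrix whose rows are $E,\ (\cos t)w_1+(\sin t)w_2,\ R_1,\dots,R_{m-2}$ (in this order) are all non-positive or all non-negative.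
   Context: A sequence $\{x_i\}_{i=1}^m\subset\mathbb{R}^n$ is a frame for $\mathbb{R}^n$ if there are $0<A\le B<\infty$ with $A\|x\|^2\le\sum_{i=1}^m|\langle x,x_i\rangle|^2\le B\|x\|^2$ for all $x\in\mathbb{R}^n$; it is tight if one can take $A=B$. A frame $\{x_i\}_{i=1}^m$ is scalable if there exist non-negative constants $a_1,\dots,a_m$ such that $\{a_ix_i\}_{i=1}^m$ is a tight frame. For $x=(x(1),\dots,x(n))\in\mathbb{R}^n$ with $n\ge2$, the reduced diagram vector $\tilde{x}\in\mathbb{R}^{(n-1)(n+2)/2}$ is $\frac{1}{\sqrt{n-1}}$ times the vector whose first $n-1$ entries are $x(1)^2-x(j)^2$, $j=2,\dots,n$, and whose remaining $n(n-1)/2$ entries are $\sqrt{2n}\,x(i)x(j)$, $1\le i<j\le n$. The reduced diagram matrix $\tilde{\theta}_{\mathcal{X}}$ is the $\frac{(n-1)(n+2)}{2}\times m$ matrix whose $i$-th column is $\tilde{x}_i$. The cofactor of the entry in position $(i,j)$ of a square matrix is $(-1)^{i+j}$ times the determinant of the submatrix obtained by deleting row $i$ and column $j$; in particular the cofactors of $\alpha_1,\dots,\alpha_m$ here do not depend on the values of the $\alpha_j$.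
   Formalization: The frame vectors x_i are assumed to be nonzero; without this the claim fails, e.g. for the frame (1,0), (1,1), 0, 0 of R^2, which meets the cofactor criterion but is not scalable. *)

(* Defs.v *)
From mathcomp Require Import all_boot all_order all_algebra.
From mathcomp Require Import reals.

Set Implicit Arguments.
Unset Strict Implicit.
Unset Printing Implicit Defensive.

Import Order.TTheory GRing.Theory Num.Theory.
Local Open Scope ring_scope.

(* The norm that the library puts on row vectors is the sup norm, so the
   Euclidean norm is expressed through [dotp]: ||u||^2 = dotp u u. *)
Definition dotp (R : realType) (n : nat) (u v : 'rV[R]_n) : R :=
  \sum_(k < n) u 0 k * v 0 k.

Definition frame_bounds (R : realType) (n m : nat) (x : 'I_m -> 'rV[R]_n)
    (A B : R) : Prop :=
  [/\ 0 < A, A <= B &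
      forall v : 'rV[R]_n,
        A * dotp v v <= \sum_(i < m) `|dotp v (x i)| ^+ 2 <= B * dotp v v].

(* Zero vectors are allowed here.  The cofactor criterion for scalability needs
   nonzero frame vectors: (1,0), (1,1), 0, 0 is a frame of R^2 that meets the
   criterion without being scalable. *)
Definition is_frame (R : realType) (n m : nat) (x : 'I_m -> 'rV[R]_n) : Prop :=
  exists A B : R, frame_bounds x A B.

Definition is_tight_frame (R : realType) (n m : nat) (x : 'I_m -> 'rV[R]_n) :
    Prop :=
  exists A : R, frame_bounds x A A.

Definition scalable_frame (R : realType) (n m : nat) (x : 'I_m -> 'rV[R]_n) :
    Prop :=
  exists a : 'I_m -> R,
    (forall i, 0 <= a i) /\ is_tight_frame (fun i => a i *: x i).

(* Indices are 0-based: in the first block the pairs (i, j) with i = 0 < j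
   give the entries x(1)^2 - x(j)^2. *)
Definition reduced_diagram_entries (R : realType) (n : nat) (x : 'rV[R]_n) :
    seq R :=
  [seq x 0 p.1 ^+ 2 - x 0 p.2 ^+ 2
     | p in [pred p : 'I_n * 'I_n | (p.1 == 0 :> nat)%N && (p.1 < p.2)%N]] ++
  [seq Num.sqrt (2 * n)%:R * x 0 p.1 * x 0 p.2
     | p in [pred p : 'I_n * 'I_n | (p.1 < p.2)%N]].

Definition reduced_diagram_dim (n : nat) : nat := ((n - 1) * (n + 2) %/ 2)%N.

Lemma size_reduced_diagram_entries (R : realType) (n : nat) (x : 'rV[R]_n) :
  size (reduced_diagram_entries x) = reduced_diagram_dim n.
Proof.
have card_rel (P : rel 'I_n) :
    #|[pred p : 'I_n * 'I_n | P p.1 p.2]| = (\sum_(j < n) #|[pred i | P i j]|)%N.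
  rewrite -sum1_card -(pair_big_dep xpredT (fun i j => P i j) (fun _ _ => 1%N)) /=.
  rewrite (exchange_big_dep xpredT) //=.
  by apply: eq_bigr => j _; rewrite sum1_card.
rewrite size_cat !size_image.
rewrite (card_rel (fun i j => (i == 0 :> nat)%N && (i < j)%N)).
rewrite (card_rel (fun i j => (i < j)%N)).
have -> : (\sum_(j < n) #|[pred i : 'I_n | (i < j)%N]| = 'C(n, 2))%N.
  rewrite -bin2_sum big_mkord; apply: eq_bigr => j _.
  by rewrite -sum1_card (big_ord_narrow (ltnW (ltn_ord j))) sum1_card card_ord.
have -> : (\sum_(j < n) #|[pred i : 'I_n | (i == 0 :> nat) && (i < j)]| = n - 1)%N.
  case: n {x card_rel} => [|n]; first by rewrite big_ord0.
  rewrite big_ord_recl eq_card0 => [|i]; last by rewrite !inE ltn0 andbF.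
  rewrite (eq_bigr (fun => 1%N)) ?sum1_card ?card_ord ?add0n ?subn1 // => j _.
  rewrite (@eq_card1 _ ord0) // => i; rewrite !inE -val_eqE /=.
  by case: (val i).
rewrite /reduced_diagram_dim bin2 -divn2 -divnMDl //; congr (_ %/ 2)%N.
by rewrite subn1 (mulnC n) -mulnDr addnC.
Qed.

Definition reduced_diagram (R : realType) (n : nat) (x : 'rV[R]_n) :
    'cV[R]_(reduced_diagram_dim n) :=
  \col_k ((Num.sqrt (n%:R - 1))^-1 * (reduced_diagram_entries x)`_k).

Definition reduced_diagram_mx (R : realType) (n m : nat)
    (x : 'I_m -> 'rV[R]_n) : 'M[R]_(reduced_diagram_dim n, m) :=
  \matrix_(k, i) reduced_diagram (x i) k 0.

Definition mx_of_rows (R : realType) (m : nat) (s : seq 'rV[R]_m) : 'M[R]_m :=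
  \matrix_(i < m) s`_i.

(* Main.v *)
(* The frame is scalable iff the reduced diagram matrix theta kills some nonzero
   b >= 0: with b_i = a_i^2, the equation theta b = 0 says that the frame
   operator of (a_i x_i) is a multiple A of the identity, and A > 0 because the
   x_i do not vanish.  The kernel of theta is the plane orthogonal to the rows
   R_i.  For each t the cofactor vector c(t) is nonzero, lies in this plane and
   is orthogonal to w(t) = cos t w1 + sin t w2, so it spans the line that
   these conditions define.  Given b in the plane, some w(t) is orthogonal to b,
   and then c(t) is a multiple of b. *)
Require Import Defs.
From mathcomp Require Import all_boot all_order all_algebra.
From mathcomp Require Import ring lra.
From mathcomp Require Import reals trigo.

Set Implicit Arguments.
Unset Strict Implicit.
Unset Printing Implicit Defensive.

Import Order.TTheory GRing.Theory Num.Theory.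
Local Open Scope ring_scope.

(** * Frame operators and the kernel of the reduced diagram matrix *)

Definition frame_operator (R : realType) (n m : nat) (x : 'I_m -> 'rV[R]_n)
    (b : 'rV[R]_m) : 'M[R]_n :=
  \matrix_(k, l) \sum_(i < m) b 0 i * (x i 0 k * x i 0 l).

Lemma frame_operatorE (R : realType) (n m : nat) (x : 'I_m -> 'rV[R]_n)
    (b : 'rV[R]_m) (v : 'rV[R]_n) :
  \sum_(i < m) b 0 i * dotp v (x i) ^+ 2 = (v *m frame_operator x b *m v^T) 0 0.
Proof.
transitivity (\sum_(l < n) \sum_(k < n) \sum_(i < m)
    b 0 i * ((v 0 k * x i 0 k) * (v 0 l * x i 0 l))).
  under [RHS]eq_bigr => l _ do rewrite exchange_big /=.
  rewrite exchange_big; apply: eq_bigr => i _ /=.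
  rewrite expr2 [X in _ * (_ * X)]/dotp !mulr_sumr; apply: eq_bigr => l _.
  rewrite /dotp mulr_suml mulr_sumr; exact: eq_bigr.
rewrite mxE; apply: eq_bigr => l _; rewrite !mxE mulr_suml.
apply: eq_bigr => k _; rewrite mxE mulr_sumr mulr_suml.
by apply: eq_bigr => i _; ring.
Qed.

Lemma frame_operator_tr (R : realType) (n m : nat) (x : 'I_m -> 'rV[R]_n)
    (b : 'rV[R]_m) :
  (frame_operator x b)^T = frame_operator x b.
Proof.
apply/matrixP => k l; rewrite !mxE.
by apply: eq_bigr => i _; rewrite [x i 0 l * _]mulrC.
Qed.

Lemma dotpE (R : realType) (n : nat) (v : 'rV[R]_n) : dotp v v = (v *m v^T) 0 0.
Proof. by rewrite mxE; apply: eq_bigr => k _; rewrite mxE. Qed.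

(** Polarization: the value at e_k is the diagonal entry S k k, and once these vanish the value at
    e_k + e_l is 2 S k l. *)
Lemma sym_quad_form_eq0 (R : realType) (n : nat) (S : 'M[R]_n) :
  S^T = S -> (forall v : 'rV_n, (v *m S *m v^T) 0 0 = 0) -> S = 0.
Proof.
move=> Ssym S0.
have formE k l : ((delta_mx 0 k : 'rV_n) *m S *m (delta_mx 0 l : 'rV_n)^T) 0 0 = S k l.
  by rewrite -rowE trmx_delta -colE !mxE.
have diag k : S k k = 0 by rewrite -formE S0.
apply/matrixP => k l; rewrite [RHS]mxE.
have := S0 (delta_mx 0 k + delta_mx 0 l).
rewrite linearD /= mulmxDl mulmxDr !mulmxDl.
rewrite [_ 0 0]mxE [(_ + _ : 'M_1) 0 0]mxE [X in _ + X]mxE !formE !diag.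
have -> : S l k = S k l by rewrite -[in LHS]Ssym mxE.
by move=> h; lra.
Qed.

(** The two frame inequalities with equal bounds say that the symmetric matrices on both sides have
    the same quadratic form. *)
Lemma tight_frameE (R : realType) (n m : nat) (x : 'I_m -> 'rV[R]_n)
    (a : 'I_m -> R) :
  is_tight_frame (fun i => a i *: x i) <->
  exists2 A : R, 0 < A & frame_operator x (\row_i a i ^+ 2) = A%:M.
Proof.
have sumE v : \sum_(i < m) `|dotp v (a i *: x i)| ^+ 2 =
    (v *m frame_operator x (\row_i a i ^+ 2) *m v^T) 0 0.
  rewrite -frame_operatorE; apply: eq_bigr => i _.
  rewrite mxE real_normK ?num_real // -exprMn; congr (_ ^+ 2).
  by rewrite /dotp mulr_sumr; apply: eq_bigr => k _; rewrite mxE; ring.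
split=> [[A [A0 _ hA]] | [A A0 hA]]; exists A => //.
  apply/eqP; rewrite -subr_eq0; apply/eqP/sym_quad_form_eq0.
    by rewrite linearB /= frame_operator_tr tr_scalar_mx.
  move=> v; rewrite mulmxBr mulmxBl mxE -sumE mul_mx_scalar -scalemxAl.
  rewrite [(- _ : 'M_1) 0 0]mxE [(_ *: _ : 'M_1) 0 0]mxE -dotpE.
  by apply/eqP; rewrite subr_eq0 eq_le andbC.
split=> // v; rewrite sumE hA mul_mx_scalar -scalemxAl mxE -dotpE.
by rewrite lexx.
Qed.

(** Up to nonzero factors, the entries of theta b are S_11 - S_jj and S_ij with i < j, where S is
    the frame operator; for symmetric S they all vanish exactly when S is scalar. *)
Lemma mul_reduced_diagram_mx_eq0 (R : realType) (n m : nat) (hn : (2 <= n)%N)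
    (x : 'I_m -> 'rV[R]_n) (b : 'rV[R]_m) :
  reduced_diagram_mx x *m b^T = 0 <->
  exists A : R, frame_operator x b = A%:M.
Proof.
case: n hn x => // n hn x; set S := frame_operator x b.
pose P := ('I_n.+1 * 'I_n.+1)%type.
(* Index pairs in the order of the entries, tagged by block, so that no position has to be
   computed. *)
pose idx : seq (P + P) :=
  [seq inl p | p : P in [pred p : P | (p.1 == 0 :> nat)%N && (p.1 < p.2)%N]] ++
  [seq inr p | p : P in [pred p : P | (p.1 < p.2)%N]].
pose entry (y : 'rV[R]_n.+1) (q : P + P) : R := match q with
  | inl p => y 0 p.1 ^+ 2 - y 0 p.2 ^+ 2
  | inr p => Num.sqrt (2 * n.+1)%:R * y 0 p.1 * y 0 p.2 end.
have entriesE y : reduced_diagram_entries y = map (entry y) idx.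
  by rewrite map_cat -!map_comp.
have size_idx : size idx = reduced_diagram_dim n.+1.
  by rewrite -(size_map (entry 0)) -entriesE size_reduced_diagram_entries.
have scale_neq0 : (Num.sqrt ((n.+1)%:R - 1))^-1 != 0 :> R.
  by rewrite invr_eq0 gt_eqF // sqrtr_gt0 subr_gt0 ltr1n.
have sqrt_neq0 : Num.sqrt (2 * n.+1)%:R != 0 :> R.
  by rewrite gt_eqF // sqrtr_gt0 ltr0n muln_gt0.
have kerE : reduced_diagram_mx x *m b^T = 0 <->
    forall q, q \in idx -> \sum_i b 0 i * entry (x i) q = 0.
  have rowE k : (reduced_diagram_mx x *m b^T) k 0 =
      (Num.sqrt ((n.+1)%:R - 1))^-1 *
      \sum_i b 0 i * entry (x i) (nth (inl (0, 0)) idx k).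
    rewrite mxE mulr_sumr; apply: eq_bigr => i _; rewrite !mxE entriesE.
    by rewrite (nth_map (inl (0, 0))) ?size_idx //; ring.
  split=> [h0 q /(nthP (inl (0, 0))) [k]|h0].
    rewrite size_idx => ltk <-; have /eqP := rowE (Ordinal ltk).
    by rewrite h0 mxE eq_sym mulf_eq0 (negPf scale_neq0) => /eqP.
  apply/matrixP => k j; rewrite (ord1 j) rowE h0 ?mulr0 ?mxE //.
  by rewrite mem_nth ?size_idx.
have sum_inl p : \sum_i b 0 i * entry (x i) (inl p) = S p.1 p.1 - S p.2 p.2.
  by rewrite !mxE -sumrB; apply: eq_bigr => i _ /=; ring.
have sum_inr p : \sum_i b 0 i * entry (x i) (inr p) =
    Num.sqrt (2 * n.+1)%:R * S p.1 p.2.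
  by rewrite !mxE mulr_sumr; apply: eq_bigr => i _ /=; ring.
rewrite kerE; split=> [h0|[A hA] q].
  have diag j : S j j = S 0 0.
    have [->//|j0] := eqVneq j 0.
    apply/esym/eqP; rewrite -subr_eq0 -(sum_inl (0, j)) h0 //.
    rewrite mem_cat map_f // mem_enum inE /= lt0n.
    by apply: contra j0 => /eqP j0; apply/eqP/val_inj.
  have upper (k l : 'I_n.+1) : (k < l)%N -> S k l = 0.
    move=> kl; have kl_idx : inr (k, l) \in idx.
      by rewrite mem_cat [X in _ || X]map_f ?orbT // mem_enum.
    have /eqP := h0 _ kl_idx.
    by rewrite sum_inr mulf_eq0 (negPf sqrt_neq0) => /eqP.
  exists (S 0 0); apply/matrixP => k l; rewrite [RHS]mxE.
  case: (ltngtP k l) => [kl|lk|/val_inj ->]; last by rewrite eqxx diag.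
    by rewrite upper // -val_eqE /= ltn_eqF.
  by rewrite -[S]frame_operator_tr mxE upper // -val_eqE /= gtn_eqF.
rewrite mem_cat => /orP[] /mapP [p]; rewrite mem_enum inE => hp ->.
  by rewrite sum_inl hA !mxE !eqxx subrr.
by rewrite sum_inr hA mxE -val_eqE /= ltn_eqF ?mulr0.
Qed.

Lemma scalable_frameP (R : realType) (n m : nat) (hn : (2 <= n)%N)
    (x : 'I_m -> 'rV[R]_n) (hx0 : forall i, x i != 0) :
  scalable_frame x <->
  exists b : 'rV[R]_m,
    [/\ forall i, 0 <= b 0 i, b != 0 & reduced_diagram_mx x *m b^T = 0].
Proof.
split=> [[a [a0 /tight_frameE [A A0 hA]]] | [b [b0 bn0 /mul_reduced_diagram_mx_eq0]]].
  exists (\row_i a i ^+ 2); split=> [i||]; first by rewrite mxE sqr_ge0.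
    (* With b = 0 the diagonal entry A of the frame operator would be 0. *)
    apply: contraTneq A0 => b0; move/matrixP: hA; rewrite b0.
    move=> /(_ (Ordinal (ltnW hn)) (Ordinal (ltnW hn))).
    rewrite !mxE eqxx mulr1n => <-; rewrite big1 ?ltxx // => i _.
    by rewrite mxE mul0r.
  by apply/mul_reduced_diagram_mx_eq0 => //; exists A.
case=> // A hA; exists (fun i => Num.sqrt (b 0 i)).
split=> [i|]; first exact: sqrtr_ge0.
have bE : b = \row_i Num.sqrt (b 0 i) ^+ 2.
  by apply/rowP => i; rewrite mxE sqr_sqrtr.
apply/tight_frameE; exists A; last by rewrite -bE.
(* A is the sum over i of b_i x_i(k)^2 for every k; this k makes the term of one i positive. *)
have /rV0Pn [i bi0] := bn0; have /rV0Pn [k xk0] := hx0 i.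
have -> : A = frame_operator x b k k by rewrite hA mxE eqxx.
rewrite mxE (bigD1 i) //= ltr_pwDl //.
  by rewrite mulr_gt0 ?lt0r ?bi0 ?b0 // -expr2 sqr_ge0 mulf_neq0.
by apply: sumr_ge0 => j _; rewrite mulr_ge0 // -expr2 sqr_ge0.
Qed.

(** * Independent rows, cofactors along the first row, and plane rotations *)

Lemma row_free_matrix_of_rows (F : fieldType) (m k : nat) (s : seq 'rV[F]_m) :
  size s = k -> free s -> row_free (\matrix_(i < k) s`_i).
Proof.
move=> sk; subst k => fs; have /freeP := (fs : free (in_tuple s)) => {}fs.
apply: inj_row_free => v /=; rewrite mulmx_sum_row => v0.
apply/rowP => i; rewrite mxE; apply: fs; rewrite -[RHS]v0.
by apply: eq_bigr => j _; rewrite rowK.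
Qed.

Lemma unitmx_of_rows (R : realType) (m : nat) (s : seq 'rV[R]_m) :
  size s = m -> free s -> mx_of_rows s \in unitmx.
Proof. by move=> sm fs; rewrite -row_free_unit; apply: row_free_matrix_of_rows. Qed.

Lemma mul_mx_of_rows (R : realType) (m : nat) (s : seq 'rV[R]_m) (b : 'rV[R]_m)
    (i : 'I_m) :
  (mx_of_rows s *m b^T) i 0 = dotp s`_i b.
Proof. by rewrite mxE; apply: eq_bigr => j _; rewrite !mxE. Qed.

(* By Laplace expansion these do not depend on the head of [s], and the vector
   they form is orthogonal to every other row. *)
Definition head_cofactors (R : realType) (m : nat) (s : seq 'rV[R]_m.+1) :
    'rV[R]_m.+1 :=
  \row_j cofactor (mx_of_rows s) ord0 j.

Lemma head_cofactors_cons (R : realType) (m : nat) (u v : 'rV[R]_m.+1)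
    (s : seq 'rV[R]_m.+1) :
  head_cofactors (u :: s) = head_cofactors (v :: s).
Proof.
apply/rowP => j; rewrite !mxE; congr (_ * \det _).
by apply/matrixP => k l; rewrite !mxE.
Qed.

(** The cofactors along the first row form the first column of the adjugate. *)
Lemma mul_head_cofactors (R : realType) (m : nat) (s : seq 'rV[R]_m.+1) :
  mx_of_rows s *m (head_cofactors s)^T = \det (mx_of_rows s) *: delta_mx ord0 0.
Proof.
have -> : (head_cofactors s)^T = \adj (mx_of_rows s) *m delta_mx ord0 0.
  by rewrite -colE; apply/colP => j; rewrite !mxE.
by rewrite mulmxA mul_mx_adj mul_scalar_mx.
Qed.

(** The inverse rotation recovers w1 and w2, so the span keeps its dimension, which is the length of
    the list. *)
Lemma free_rotate (R : realType) (m : nat) (w1 w2 : 'rV[R]_m)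
    (s : seq 'rV[R]_m) (p q : R) :
  p ^+ 2 + q ^+ 2 = 1 -> free [:: w1, w2 & s] ->
  free [:: p *: w2 - q *: w1, p *: w1 + q *: w2 & s].
Proof.
move=> pq1; rewrite /free => /eqP hw; set r := [:: _, _ & s].
rewrite eqn_leq dim_span -[X in (X <= _)%N]hw dimvS //.
apply/span_subvP => u; rewrite !inE.
have mem0 : p *: w2 - q *: w1 \in <<r>>%VS by rewrite memv_span ?mem_head.
have mem1 : p *: w1 + q *: w2 \in <<r>>%VS by rewrite memv_span // !inE eqxx orbT.
case/or3P => [/eqP->|/eqP->|us].
- have -> : w1 = p *: (p *: w1 + q *: w2) - q *: (p *: w2 - q *: w1).
    by apply/rowP => i; rewrite !mxE -[LHS]mul1r -pq1; ring.
  by rewrite memvB ?memvZ.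
- have -> : w2 = q *: (p *: w1 + q *: w2) + p *: (p *: w2 - q *: w1).
    by apply/rowP => i; rewrite !mxE -[LHS]mul1r -pq1; ring.
  by rewrite memvD ?memvZ.
by rewrite memv_span // !inE us !orbT.
Qed.

(** The unit vector (cos t, sin t) is (p, q) turned by a quarter turn and divided by its length
    r. *)
Lemma orthogonal_angle (R : realType) (p q : R) :
  exists2 t : R, 0 <= t < 2 * pi & cos t * p + sin t * q = 0.
Proof.
pose r := Num.sqrt (p ^+ 2 + q ^+ 2).
have [r0|r_neq0] := eqVneq r 0.
  have : p ^+ 2 + q ^+ 2 <= 0 by rewrite -sqrtr_eq0 -/r r0.
  have p2 := sqr_ge0 p; have q2 := sqr_ge0 q => pq.
  have /eqP : p ^+ 2 = 0 by lra.
  have /eqP : q ^+ 2 = 0 by lra.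
  rewrite !sqrf_eq0 => /eqP -> /eqP ->; exists 0; last by rewrite !mulr0 addr0.
  by rewrite lexx mulr_gt0 ?pi_gt0.
have r2 : r ^+ 2 = p ^+ 2 + q ^+ 2 by rewrite sqr_sqrtr // addr_ge0 ?sqr_ge0.
(* Negating (p, q) preserves the equation, and p >= 0 matches the sign of sin on the range of
   [acos]. *)
wlog p0 : p q @r r_neq0 r2 / 0 <= p => [th|].
  have [/th|/ltW p0] := leP 0 p; first exact.
  have := th (- p) (- q); rewrite /= !sqrrN oppr_ge0 => /(_ r_neq0 r2 p0) [t ht h].
  by exists t => //; lra.
have rpos : 0 < r by rewrite lt0r r_neq0 sqrtr_ge0.
pose u := - q / r.
have u2 : 1 - u ^+ 2 = (p / r) ^+ 2.
  have -> : 1 - u ^+ 2 = (r ^+ 2 - q ^+ 2) / r ^+ 2 by rewrite /u; field.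
  by rewrite r2 addrK -r2 expr_div_n.
have u1 : -1 <= u <= 1.
  by rewrite -ler_norml -(@expr_le1 _ 2) // real_normK ?num_real // -subr_ge0 u2 sqr_ge0.
have pi0 := pi_gt0 R.
exists (acos u).
  by rewrite acos_ge0 //=; have := acos_lepi u1; lra.
rewrite acosK // sin_acos // u2 sqrtr_sqr ger0_norm ?divr_ge0 //.
  by rewrite /u; field.
exact: ltW.
Qed.

Theorem theorem3p15 (R : realType) (n m : nat) (hn : (2 <= n)%N)
    (x : 'I_m -> 'rV[R]_n) (hx : is_frame x) (hx0 : forall i, x i != 0)
    (hrank : \rank (reduced_diagram_mx x) = (m - 2)%N)
    (Rs : (m - 2).-tuple 'rV[R]_m)
    (hRs_rows : forall r, r \in Rs -> exists k, r = row k (reduced_diagram_mx x))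
    (hRs_free : free Rs)
    (w1 w2 : 'rV[R]_m) (hw : free [:: w1, w2 & Rs])
    (E : 'rV[R]_m) :
  scalable_frame x <->
  exists t : R, 0 <= t < 2 * pi /\
    let M := mx_of_rows [:: E, cos t *: w1 + sin t *: w2 & Rs] in
    (forall i j : 'I_m, i = 0%N :> nat -> cofactor M i j <= 0) \/
    (forall i j : 'I_m, i = 0%N :> nat -> 0 <= cofactor M i j).
Proof.
have w_size : size [:: w1, w2 & Rs] = (2 + (m - 2))%N by rewrite /= size_tuple.
(* The subtraction is truncated; m >= 2 holds because 2 + (m - 2) independent vectors fit into
   dimension m. *)
have m2 : (2 + (m - 2) = m)%N.
  apply/subnKC/(leq_trans (leq_addr (m - 2) 2)).
  move: hw; rewrite -w_size /free => /eqP <-.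
  by apply: leq_trans (dimvS (subvf _)) _; rewrite dimvf /dim /= mul1n.
have kerE (b : 'rV[R]_m) : (forall r, r \in (Rs : seq _) -> dotp r b = 0) <->
    reduced_diagram_mx x *m b^T = 0.
  set theta := reduced_diagram_mx x.
  pose Rm : 'M[R]_(m - 2, m) := \matrix_(i < m - 2) Rs`_i.
  have Rm_rank : \rank Rm = (m - 2)%N.
    by apply/eqP/(row_free_matrix_of_rows _ hRs_free); rewrite size_tuple.
  have Rm_sub : (Rm <= theta)%MS.
    apply/row_subP => i; rewrite rowK.
    have [|k ->] := hRs_rows Rs`_i; first by rewrite mem_nth ?size_tuple.
    exact: row_sub.
  (* Equal ranks turn the inclusion of row spaces into an equality. *)
  have /submxP [D thetaE] : (theta <= Rm)%MS.
    by rewrite -(geq_leqif (mxrank_leqif_sup Rm_sub)) hrank Rm_rank.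
  split=> [h|h r /hRs_rows [k ->]].
    rewrite thetaE -mulmxA (_ : Rm *m b^T = 0) ?mulmx0 //.
    apply/matrixP => i j; rewrite (ord1 j) !mxE.
    rewrite -[RHS](h Rs`_i) ?mem_nth ?size_tuple //.
    by apply: eq_bigr => l _; rewrite !mxE.
  have /matrixP/(_ k 0) := h; rewrite !mxE => <-.
  by apply: eq_bigr => l _; rewrite !mxE.
rewrite (scalable_frameP hn hx0).
case: m m2 => // m' m2 in x hx hx0 hrank Rs hRs_rows hRs_free w1 w2 hw E w_size kerE *.
(* A quarter turn of w(t): put in place of [E], it makes the matrix invertible and leaves the
   cofactors of the first row unchanged. *)
pose v t := cos t *: w2 - sin t *: w1.
pose w t := cos t *: w1 + sin t *: w2.
have rows_unit t : mx_of_rows [:: v t, w t & Rs] \in unitmx.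
  apply: unitmx_of_rows; first by rewrite -[RHS]m2 -w_size.
  by apply: free_rotate => //; rewrite cos2Dsin2.
have cofE t j (i : 'I_m'.+1) : i = 0%N :> nat ->
    cofactor (mx_of_rows [:: E, w t & Rs]) i j =
    head_cofactors [:: v t, w t & Rs] 0 j.
  by move=> i0; rewrite (head_cofactors_cons _ E) mxE; congr cofactor; apply: val_inj.
split=> [[b [b0 bn0 /kerE bR]]|[t [ht hM]]].
  have [t ht wb] := orthogonal_angle (dotp w1 b) (dotp w2 b).
  exists t; split=> //=.
  set M := mx_of_rows [:: v t, w t & Rs].
  set c := head_cofactors [:: v t, w t & Rs].
  (* All rows of [M] after the first are orthogonal to b and to c, so [M] sends both to multiples of
     the first basis vector; inverting [M] makes them proportional. *)
  have Mb : M *m b^T = dotp (v t) b *: delta_mx ord0 0.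
    apply/colP => i; rewrite mul_mx_of_rows !mxE eqxx andbT.
    case: i => [[|[|i]] hi] /=; rewrite ?mulr1 ?mulr0 //.
      rewrite -[RHS]wb /dotp !mulr_sumr -big_split; apply: eq_bigr => k _ /=.
      by rewrite !mxE; ring.
    by rewrite bR // mem_nth // -ltnS -ltnS; rewrite -[X in (_ <= X)%N]m2 -w_size in hi.
  have cb : dotp (v t) b *: c = \det M *: b.
    apply/trmx_inj/(can_inj (mulKmx (rows_unit t))).
    by rewrite !linearZ /= mul_head_cofactors Mb !scalerA mulrC.
  have vb0 : dotp (v t) b != 0.
    apply: contra bn0 => /eqP vb0; apply/eqP/trmx_inj.
    by apply: (can_inj (mulKmx (rows_unit t))); rewrite Mb vb0 scale0r trmx0 mulmx0.
  have cE j : c 0 j = \det M / dotp (v t) b * b 0 j.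
    have /rowP/(_ j) := cb; rewrite !mxE => cbj.
    by apply: (mulfI vb0); rewrite cbj; field.
  (* Since b >= 0, the sign of this factor is the common sign of the cofactors. *)
  case: (leP 0 (\det M / dotp (v t) b)) => [d0|/ltW d0]; [right|left];
    move=> i j i0; rewrite (cofE t j i i0) -/c cE.
    exact: mulr_ge0.
  exact: mulr_le0_ge0.
set c := head_cofactors [:: v t, w t & Rs].
(* The first entry of the matrix times c is its determinant, which is nonzero. *)
have cn0 : c != 0.
  apply/eqP => c0; have := mul_head_cofactors [:: v t, w t & Rs].
  rewrite -/c c0 trmx0 mulmx0 => /colP/(_ ord0); rewrite !mxE eqxx mulr1 => /esym/eqP.
  by apply/negP; rewrite -unitfE -unitmxE.
have cR : reduced_diagram_mx x *m c^T = 0.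
  apply/kerE => r /(nthP 0) [i hi <-].
  (* The vector of index i in [Rs] is row i + 2 of the matrix, after v(t) and w(t). *)
  have hi2 : (i.+2 < m'.+1)%N by rewrite -[X in (_ < X)%N]m2 -w_size /= !ltnS.
  have := mul_mx_of_rows [:: v t, w t & Rs] c (Ordinal hi2) => /= <-.
  by rewrite mul_head_cofactors !mxE mulr0.
case: hM => hM; [exists (- c)|exists c]; split=> //.
- by move=> i; rewrite mxE oppr_ge0 /c -(cofE t i ord0) //; apply: hM.
- by rewrite oppr_eq0.
- by rewrite linearN /= mulmxN cR oppr0.
- by move=> i; rewrite /c -(cofE t i ord0) //; apply: hM.
Qed.
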